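(* Let $S$ be a semiring such that every proper congruence on $S$ is contained in some prime congruence on $S$. Then the topological space $\operatorname{CSpec}(S)$ (with the Zariski topology) is quasi-compact.
   Context: A semiring is a commutative semiring $(S,+,\cdot)$ with additive identity $0_S$ (absorbing for multiplication) and multiplicative identity $1_S$. A congruence on $S$ is an equivalence relation $C\subset S\times S$ such that $(a,b),(c,d)\in C$ implies $(a+c,b+d)\in C$ and $(a\cdot c,b\cdot d)\in C$. It is proper if $C\neq S\times S$. A congruence $C$ is prime if it is proper and $(a\cdot c+b\cdot d,\ a\cdot d+b\cdot c)\in C$ implies $(a,b)\in C$ or $(c,d)\in C$. The congruence spectrum $\operatorname{CSpec}(S)$ is the set of prime congruences on $S$, equipped with the Zariski topology, whose closed sets are the sets $V(C)=\{P\in\operatorname{CSpec}(S)\mid C\subset P\}$ for $C$ a congruence on $S$. Quasi-compact means that every open cover has a finite subcover (no Hausdorff condition). *)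

(* Defs.v *)
From HB Require Import structures.
From mathcomp Require Import all_boot all_order all_algebra.
From mathcomp Require Import all_classical.
From mathcomp Require Import topology.

Set Implicit Arguments.
Unset Strict Implicit.
Unset Printing Implicit Defensive.

Import GRing.Theory.
Local Open Scope classical_set_scope.
Local Open Scope ring_scope.

(* [comPzSemiRingType] allows 0 = 1, so the trivial semiring is included. *)

Record congruence (S : comPzSemiRingType) (C : set (S * S)) : Prop := {
  congruence_refl : forall a, C (a, a);
  congruence_sym : forall a b, C (a, b) -> C (b, a);
  congruence_trans : forall a b c, C (a, b) -> C (b, c) -> C (a, c);
  congruence_add : forall a b c d, C (a, b) -> C (c, d) -> C (a + c, b + d);
  congruence_mul : forall a b c d, C (a, b) -> C (c, d) -> C (a * c, b * d) }.

Definition proper_congruence (S : comPzSemiRingType) (C : set (S * S)) : Prop :=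
  congruence C /\ C <> setT.

Definition prime_congruence (S : comPzSemiRingType) (C : set (S * S)) : Prop :=
  proper_congruence C /\
  forall a b c d : S, C (a * c + b * d, a * d + b * c) -> C (a, b) \/ C (c, d).

Record CSpec (S : comPzSemiRingType) : Type := MkCSpec {
  cspec_rel :> set (S * S);
  cspec_prime : prime_congruence cspec_rel }.

HB.instance Definition _ (S : comPzSemiRingType) := gen_eqMixin (CSpec S).
HB.instance Definition _ (S : comPzSemiRingType) := gen_choiceMixin (CSpec S).

Definition zariskiV (S : comPzSemiRingType) (C : set (S * S)) : set (CSpec S) :=
  [set P : CSpec S | C `<=` P].

Definition zariski_closed (S : comPzSemiRingType) (A : set (CSpec S)) : Prop :=
  exists2 C : set (S * S), congruence C & A = zariskiV C.

Definition zariski_open (S : comPzSemiRingType) (U : set (CSpec S)) : Prop :=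
  zariski_closed (~` U).

Section ZariskiTopology.
Variable S : comPzSemiRingType.
Implicit Types (P : CSpec S) (C X : set (S * S)).

Lemma cspec_congruence P : congruence P.
Proof. by have [[]] := cspec_prime P. Qed.

Lemma congruence_smallest X : congruence (smallest (@congruence S) X).
Proof.
split.
- by move=> a C [cC _]; exact: congruence_refl.
- by move=> a b Xab C CX; apply: (congruence_sym CX.1); exact: Xab.
- move=> a b c Xab Xbc C CX.
  by apply: (congruence_trans CX.1); [exact: Xab | exact: Xbc].
- move=> a b c d Xab Xcd C CX.
  by apply: (congruence_add CX.1); [exact: Xab | exact: Xcd].
- move=> a b c d Xab Xcd C CX.
  by apply: (congruence_mul CX.1); [exact: Xab | exact: Xcd].
Qed.

Lemma zariskiV_smallest X :
  zariskiV (smallest (@congruence S) X) = zariskiV X.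
Proof.
apply/seteqP; split=> P /= XP.
- by move=> x Xx; apply: XP => C [_]; apply.
- by move=> x; apply; split => //; exact: cspec_congruence.
Qed.

Lemma zariski_closedV X : zariski_closed (zariskiV X).
Proof.
exists (smallest (@congruence S) X); first exact: congruence_smallest.
by rewrite zariskiV_smallest.
Qed.

Definition twisted_prod C D : set (S * S) :=
  [set x | exists a b c d, [/\ C (a, b), D (c, d) &
                               x = (a * c + b * d, a * d + b * c)]].

Lemma zariskiVU C D :
  zariskiV C `|` zariskiV D = zariskiV (twisted_prod C D).
Proof.
apply/seteqP; split=> P /=.
- have cP := cspec_congruence P.
  move=> [CP|DP] _ [a [b [c [d [Cab Dcd ->]]]]].
  + rewrite [a * d + _]addrC; apply: (congruence_add cP).
      by apply: (congruence_mul cP); [exact: CP | exact: congruence_refl].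
    by apply: (congruence_mul cP);
      [apply: (congruence_sym cP); exact: CP | exact: congruence_refl].
  + apply: (congruence_add cP).
      by apply: (congruence_mul cP); [exact: congruence_refl | exact: DP].
    by apply: (congruence_mul cP);
      [exact: congruence_refl | apply: (congruence_sym cP); exact: DP].
- move=> CDP; have [CP|nCP] := pselect (C `<=` P); [by left | right].
  move=> [c d] Dcd; apply: contrapT => nPcd; apply: nCP => -[a b] Cab.
  have [_ primeP] := cspec_prime P.
  by case: (primeP a b c d) => //; apply: CDP; exists a, b, c, d.
Qed.

Lemma zariski_openT : zariski_open [set: CSpec S].
Proof.
rewrite /zariski_open setCT; exists setT => //.
apply/seteqP; split=> P //= PT; have [[_ nPT] _] := cspec_prime P.
by apply: nPT; apply/seteqP; split.
Qed.

Lemma zariski_openI (U V : set (CSpec S)) :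
  zariski_open U -> zariski_open V -> zariski_open (U `&` V).
Proof.
move=> [C _ UC] [D _ VD].
by rewrite /zariski_open setCI UC VD zariskiVU; exact: zariski_closedV.
Qed.

Lemma zariski_open_bigU (I : Type) (f : I -> set (CSpec S)) :
  (forall i, zariski_open (f i)) -> zariski_open (\bigcup_i f i).
Proof.
move=> fo; pose X : set (S * S) :=
  [set x | exists i C, ~` f i = zariskiV C /\ C x].
suff fX : ~` (\bigcup_i f i) = zariskiV X.
  by rewrite /zariski_open fX; exact: zariski_closedV.
rewrite setC_bigcup; apply/seteqP; split=> P /=.
- move=> fP x [i [C [fC Cx]]].
  by have := fP i Logic.I; rewrite fC => /(_ x Cx).
- move=> XP i _; have [C _ fC] := fo i; rewrite fC => x Cx.
  by apply: XP; exists i, C.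
Qed.

End ZariskiTopology.

HB.instance Definition _ (S : comPzSemiRingType) :=
  isOpenTopological.Build (CSpec S)
    (@zariski_openT S) (@zariski_openI S) (@zariski_open_bigU S).

Lemma closed_zariskiE (S : comPzSemiRingType) (A : set (CSpec S)) :
  closed A = zariski_closed A.
Proof. by rewrite -[A in LHS]setCK closedC /open/= /zariski_open setCK. Qed.

(* Main.v *)
Require Import Defs.
From mathcomp Require Import all_boot all_order all_algebra.
From mathcomp Require Import all_classical.
From mathcomp Require Import topology.
From mathcomp Require Import finmap.

(** Write every open set of the cover as the complement of a [zariskiV] of a
    relation [C i].  The cover condition says that no prime congruence contains
    all the [C i]; as proper congruences lie in primes, the congruence they
    generate is improper, hence contains the single pair (0, 1).  Membership of
    one pair in a generated congruence involves only finitely many generators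
    ([smallest_congruence_bigcup_finite]), so finitely many of the [C i] already
    generate (0, 1).  A congruence relating 0 and 1 is improper
    ([congruence01_setT]), so no prime contains these finitely many [C i], and
    the corresponding open sets cover the spectrum. *)

Local Open Scope classical_set_scope.
Local Open Scope ring_scope.

Import GRing.Theory.

(** Multiplying 0 ~ 1 by [a] gives 0 ~ a, so everything is related to 0. *)
Lemma congruence01_setT (S : comPzSemiRingType) (C : set (S * S)) :
  congruence C -> C (0, 1) -> C = setT.
Proof.
move=> cC C01; have C0 a : C (0, a).
  rewrite -[a]mulr1 -[X in C (X, _)](mulr0 a).
  by apply: (congruence_mul cC) => //; exact: (congruence_refl cC).
apply/seteqP; split=> -[a b] // _.
by apply: (congruence_trans cC) (C0 b); exact: (congruence_sym cC).
Qed.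

(** Each closure rule for congruences has finitely many premises, so the pairs
    generated by finite subfamilies already form a congruence: two finite index
    sets are joined before a rule is applied. *)
Lemma smallest_congruence_bigcup_finite (S : comPzSemiRingType)
    (I : choiceType) (D : set I) (C : I -> set (S * S)) (x : S * S) :
  smallest (@congruence S) (\bigcup_(i in D) C i) x ->
  exists2 F : {fset I}, [set` F] `<=` D &
    smallest (@congruence S) (\bigcup_(i in [set` F]) C i) x.
Proof.
pose G (F : {fset I}) :=
  smallest (@congruence S) (\bigcup_(i in [set` F]) C i).
have cG F : congruence (G F) by exact: congruence_smallest.
have GS (F F' : {fset I}) : {subset F <= F'} -> G F `<=` G F'.
  move=> FF'; apply: sub_smallest2r; first exact: cG.
  by apply: bigcup_subset => i /=; exact: FF'.
pose E : set (S * S) := [set y | exists2 F : {fset I}, [set` F] `<=` D & G F y].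
have E2 y z : E y -> E z ->
    exists F : {fset I}, [/\ [set` F] `<=` D, G F y & G F z].
  move=> [F FD Fy] [F' F'D F'z]; exists (F `|` F')%fset; split.
  - by move=> i /=; rewrite in_fsetU => /orP[/FD|/F'D].
  - by apply: GS Fy => i iF; rewrite in_fsetU iF.
  - by apply: GS F'z => i iF'; rewrite in_fsetU iF' orbT.
suff cE : congruence E.
  move=> /(_ E); apply; split=> // y [i Di Ciy]; exists [fset i]%fset.
    by move=> j /=; rewrite inE => /eqP ->.
  by apply: sub_gen_smallest; exists i => //=; rewrite inE.
split.
- move=> a; exists fset0; first by move=> i /=; rewrite inE.
  exact: (congruence_refl (cG _)).
- by move=> a b [F FD Fab]; exists F => //; exact: (congruence_sym (cG _)).
- move=> a b c Eab Ebc; have [F [FD Fab Fbc]] := E2 _ _ Eab Ebc.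
  by exists F => //; exact: (congruence_trans (cG _)) Fab Fbc.
- move=> a b c d Eab Ecd; have [F [FD Fab Fcd]] := E2 _ _ Eab Ecd.
  by exists F => //; exact: (congruence_add (cG _)).
- move=> a b c d Eab Ecd; have [F [FD Fab Fcd]] := E2 _ _ Eab Ecd.
  by exists F => //; exact: (congruence_mul (cG _)).
Qed.

(** The intersection of the primes in a closed set [A] is the largest relation
    cutting out [A]; having it as a function of [A] gives a whole family of
    closed sets their relations with no appeal to choice. *)
Lemma zariskiV_bigcap (S : comPzSemiRingType) (A : set (CSpec S)) :
  closed A -> zariskiV (\bigcap_(P in A) (P : set (S * S))) = A.
Proof.
rewrite closed_zariskiE => -[C _ ->]; apply/seteqP; split=> P /=.
- by move=> IP x Cx; apply: IP => Q; apply.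
- by move=> CP x; apply.
Qed.

Theorem proposition3p2 (S : comPzSemiRingType)
    (hS : forall C : set (S * S), proper_congruence C ->
            exists2 P : set (S * S), prime_congruence P & C `<=` P) :
  cover_compact [set: CSpec S].
Proof.
move=> I D f fo fcov.
pose C i : set (S * S) := \bigcap_(P in ~` f i) (P : set (S * S)).
have VC i : D i -> zariskiV (C i) = ~` f i.
  by move=> Di; apply: zariskiV_bigcap; apply: open_closedC; exact: fo.
pose E := smallest (@congruence S) (\bigcup_(i in D) C i).
have ET : E = setT.
  apply: contrapT => nET.
  have [|P pP EP] := hS E.
    by split=> //; exact: congruence_smallest.
  have [i Di fiP] := fcov (MkCSpec pP) Logic.I.
  suff : zariskiV (C i) (MkCSpec pP) by rewrite VC.
  by move=> x Cx; apply: EP; apply: sub_gen_smallest; exists i.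
have : E (0, 1) by rewrite ET.
move=> /smallest_congruence_bigcup_finite[F FD F01].
exists F; first by move=> i /FD /mem_set.
move=> P _; apply: contrapT => nFP.
have [[cP nPT] _] := cspec_prime P.
apply: nPT; apply: congruence01_setT => //; apply: F01; split => //.
move=> x [i Fi]; have /= : zariskiV (C i) P; last by apply.
by rewrite VC; [move=> fiP; apply: nFP; exists i | exact: FD].
Qed.
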